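(* Let $\Phi$ be a continuous semiflow on a Banach space $(X,\|\cdot\|_X)$ which is eventually compact and possesses a global attractor $\Gamma$, and suppose that $\Phi$ is uniformly eventually strongly monotone (UESM) with respect to nested invariant cones (NICs) $\{C^i\}_{i=0}^{N}$. Suppose moreover that there is a closed linear subspace $\Pi\subset X$ of codimension $d$ such that, for every $1\le i\le N$ and all distinct $x,y\in\mathcal{B}(\Phi)$, the following implication holds: if for every $s>0$ there exist $\tilde x,\tilde y\in\mathcal{B}(\Phi)$ with $\Phi_s(\tilde x)=x$, $\Phi_s(\tilde y)=y$ and $$\Phi_t(\tilde x)-\Phi_t(\tilde y)\in(C^i\setminus C^{i-1})\cup\{0\}\quad\text{for all }t\ge0,$$ then $x-y\notin\Pi$. Then every connected component $B$ of the Birkhoff center $\mathcal{B}(\Phi)$ is homeomorphic to a compact invariant connected set in $\mathbb{R}^d$.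
   Context: **Semiflows.** A continuous semiflow on a Banach space $X$ is a continuous map $\Phi:[0,\infty)\times X\to X$, $\Phi_t(x)=\Phi(t,x)$, with $\Phi_0=\mathrm{id}$ and $\Phi_t\circ\Phi_s=\Phi_{t+s}$ for $t,s\ge0$. It is eventually compact if there is $\tau>0$ such that $\Phi_\tau(D)$ is relatively compact for every bounded $D\subset X$. A set $A$ is invariant if $\Phi_t(A)=A$ for all $t\ge0$. A global attractor is a nonempty compact invariant set $\Gamma\subset X$ with $\lim_{t\to+\infty}\sup_{a\in\Phi_t(D)}\inf_{b\in\Gamma}\|a-b\|_X=0$ for every bounded $D\subset X$. The $\omega$-limit set is $\omega(x)=\bigcap_{t\ge0}\overline{\bigcup_{s\ge t}\{\Phi_s(x)\}}$. The point $x$ is recurrent if $x\in\omega(x)$; $\mathcal{R}(\Phi)$ is the set of recurrent points, and the Birkhoff center is $\mathcal{B}(\Phi)=\overline{\mathcal{R}(\Phi)}$. **Cones.** A closed set $C\subset X$ is a $k$-cone if $lv\in C$ for all $v\in C$, $l\in\mathbb{R}$, and $\max\{\dim W: W\subset C \text{ a linear subspace}\}=k$. It is solid if $\operatorname{Int}C\ne\emptyset$. (Cones are not assumed convex.) **UESM.** $\Phi$ is UESM with respect to a solid cone $C$ if there is $T(C)>0$ such that $x-y\in C\setminus\{0\}$ implies $\Phi_t(x)-\Phi_t(y)\in\operatorname{Int}C$ for all $t\ge T(C)$. **NICs.** A sequence of closed sets $\{C^i\}_{i=0}^N$, $N\in\mathbb{N}\cup\{+\infty\}$, is called NICs for $\Phi$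 if: (i) $\{0\}=C^0\subset\dots\subset C^{i-1}\subset C^i\subset\dots\subset C^N=X$; (ii) $C^i$ is a solid $k_i$-cone for all $0<i<N$, with $k_{i-1}<k_i$ for all $1<i<N$; (iii) for each $1\le i<N$ there is $t_*^i\ge0$ such that $x-y\in C^i$ implies $\Phi_t(x)-\Phi_t(y)\in C^i$ for every $t\ge t_*^i$. $\Phi$ is UESM with respect to the NICs if it is UESM with respect to $C^i$ for every $1\le i<N$. **Conventions.** If $N=+\infty$, the indices are $0,1,2,\dots$ together with $\infty$ (with $C^\infty=X$), and $C^{\infty-1}$ means $\bigcup_{i<\infty}C^i$. ''Invariant'' for the image set in $\mathbb{R}^d$ refers to the semiflow induced on it by transporting $\Phi|_B$ through the homeomorphism. *)

(* Defs.v *)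
(* MathComp-Analysis *)
From HB Require Import structures.
From mathcomp Require Import all_boot all_order all_algebra.
From mathcomp Require Import all_classical all_reals all_analysis.

Set Implicit Arguments.
Unset Strict Implicit.
Unset Printing Implicit Defensive.

Import Order.TTheory GRing.Theory Num.Theory.
Import numFieldNormedType.Exports.

Local Open Scope classical_set_scope.
Local Open Scope ring_scope.

Section Semiflows.
Context {R : realType}.

(* A semiflow is a total function of t : R of which only the values at t >= 0
   are constrained; no notion below looks at Phi t for t < 0. *)

Definition invariant_set {T : Type} (Phi : R -> T -> T) (A : set T) :=
  forall t, 0 <= t -> Phi t @` A = A.

Context {X : completeNormedModType R}.
Implicit Type Phi : R -> X -> X.

Definition continuous_semiflow Phi :=
  [/\ {within [set p : R * X | 0 <= p.1], continuous (fun p => Phi p.1 p.2)},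
      forall x, Phi 0 x = x &
      forall t s : R, 0 <= t -> 0 <= s ->
        forall x, Phi t (Phi s x) = Phi (t + s) x].

Definition eventually_compact Phi :=
  exists2 tau : R, 0 < tau & forall D : set X, bounded_set D ->
    precompact (Phi tau @` D).

(* The attraction condition is imposed on nonempty D only: for D = set0 the
   supremum of distances is 0 by convention, whereas ereal_sup set0 = -oo. *)
Definition global_attractor Phi (Gamma : set X) :=
  [/\ Gamma !=set0, compact Gamma, invariant_set Phi Gamma &
      forall D : set X, D !=set0 -> bounded_set D ->
        ereal_sup [set ereal_inf [set (`|a - b|)%:E | b in Gamma]
                  | a in Phi t @` D] @[t --> +oo] --> 0%:E].

Definition omega_limit Phi (x : X) : set X :=
  \bigcap_(t in [set t : R | 0 <= t])
    closure (\bigcup_(s in [set s : R | t <= s]) [set Phi s x]).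

Definition recurrent Phi (x : X) := omega_limit Phi x x.

Definition birkhoff_center Phi : set X := closure [set x | recurrent Phi x].

End Semiflows.

Section Subspaces.
Context {R : realType} {X : lmodType R}.

Definition linear_subspace (W : set X) := GRing.submod_closed [in W].

(* e is a basis of W *)
Definition dimension_is (W : set X) (n : nat) :=
  exists e : 'I_n -> X,
    (forall c : 'I_n -> R, \sum_(j < n) c j *: e j = 0 -> forall j, c j = 0) /\
    W = [set \sum_(j < n) c j *: e j | c in [set: 'I_n -> R]].

(* The classes of the e j are a basis of the quotient space X / Pi. *)
Definition codimension_is (Pi : set X) (n : nat) :=
  exists e : 'I_n -> X,
    (forall c : 'I_n -> R, Pi (\sum_(j < n) c j *: e j) -> forall j, c j = 0) /\
    (forall x, exists c : 'I_n -> R, Pi (x - \sum_(j < n) c j *: e j)).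

End Subspaces.

Section Cones.
Context {R : realType} {X : completeNormedModType R}.
Implicit Types (Phi : R -> X -> X) (C : set X).

(* The last clause also excludes infinite-dimensional subspaces of C. *)
Definition cone_of_rank (k : nat) C :=
  [/\ closed C,
      forall v (l : R), C v -> C (l *: v),
      exists W, [/\ linear_subspace W, W `<=` C & dimension_is W k] &
      forall W, linear_subspace W -> W `<=` C ->
        exists2 m, (m <= k)%N & dimension_is W m].

Definition solid C := interior C !=set0.

Definition UESM Phi C :=
  exists2 T : R, 0 < T & forall x y, (C `\ 0) (x - y) ->
    forall t, T <= t -> interior C (Phi t x - Phi t y).

(* Elements of N + {oo}: Some n is the natural number n, None is oo. *)
Definition xnat := option nat.

Definition xnat_le (i j : xnat) : bool :=
  match i, j with
  | _, None => true
  | None, Some _ => false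
  | Some m, Some n => (m <= n)%N
  end.

Definition xnat_lt (i j : xnat) : bool := ~~ xnat_le j i.

(* C^(i-1), with C^(oo-1) the union of all C^j, j finite *)
Definition pred_cone (C : xnat -> set X) (i : xnat) : set X :=
  match i with
  | Some n => C (Some n.-1)
  | None => \bigcup_(n in [set: nat]) C (Some n)
  end.

(* Only the values C i with i <= N are constrained; an index i < N is finite. *)
Record NICs Phi (N : xnat) (C : xnat -> set X) : Prop := {
  nics_closed : forall i, xnat_le i N -> closed (C i);
  nics_bottom : C (Some 0%N) = [set 0];
  nics_nested : forall i, xnat_le (Some 1%N) i -> xnat_le i N ->
    pred_cone C i `<=` C i;
  nics_top : C N = setT;
  nics_cones : exists k : nat -> nat,
    (forall i, (0 < i)%N -> xnat_lt (Some i) N ->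
       cone_of_rank (k i) (C (Some i)) /\ solid (C (Some i))) /\
    (forall i, (1 < i)%N -> xnat_lt (Some i) N -> (k i.-1 < k i)%N);
  nics_positive : forall i, (1 <= i)%N -> xnat_lt (Some i) N ->
    exists2 tstar : R, 0 <= tstar &
      forall x y, C (Some i) (x - y) ->
        forall t, tstar <= t -> C (Some i) (Phi t x - Phi t y)
}.

Definition UESM_NICs Phi (N : xnat) (C : xnat -> set X) :=
  forall i, (1 <= i)%N -> xnat_lt (Some i) N -> UESM Phi (C (Some i)).

End Cones.

(* h maps A homeomorphically onto B, with inverse homeomorphism g; the values
   of h outside A and of g outside B are irrelevant. *)
Definition homeomorphism_on {T U : topologicalType} (A : set T) (B : set U)
    (h : T -> U) (g : U -> T) :=
  [/\ set_bij A B h, (forall x, A x -> g (h x) = x),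
      {within A, continuous h} & {within B, continuous g}].

(* Main.v *)
(* The Birkhoff center is compact and invariant, so it is enough to show that
   x - y is not in Pi for distinct points x, y of it: the coordinates along Pi
   are then continuous and injective on a compact set.  By the separation
   hypothesis this follows once the least i with x - y in C^i is the same for
   all differences along a pair of orbits, i.e. once an orbit pair with nonzero
   difference in a cone C has always had its difference in C.

   Suppose that a - b is not in C but Phi_s a - Phi_s b is in Int C.  Both
   conditions are open, hence a, b may be replaced by nearby recurrent x, y.
   If the orbit of y comes close to a, take x = Phi_r y: the pair is jointly
   recurrent, and C is closed and eventually absorbing, so x - y is in C.
   Otherwise the orbit of y stays away from x; take a return time n of x.
   Starting from (x, y), flow for time n and move the first point back to x,
   repeatedly.  The moves are made away from the diagonal, where strong
   positivity on the compact attractor leaves a uniform margin inside C, so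
   x - Phi_(kn) y is in C for every k > 0.  As y is also recurrent for the map
   Phi_n, again x - y is in C. *)
Require Import Defs.
From HB Require Import structures.
From mathcomp Require Import all_boot all_order all_algebra.
From mathcomp Require Import all_classical all_reals all_analysis.
From mathcomp Require Import lra.

Set Implicit Arguments.
Unset Strict Implicit.
Unset Printing Implicit Defensive.

Import Order.TTheory GRing.Theory Num.Theory.
Import numFieldNormedType.Exports.

Local Open Scope classical_set_scope.
Local Open Scope ring_scope.

(** * Residues modulo a period *)

(** Residues modulo [p] are sorted into boxes shorter than [rho], and two of them share a box. The
    bound [M] comes before [s], so that a sequence of the required length can be built
    afterwards. *)
Lemma pigeonhole_mod {R : realType} (p rho : R) : 0 < p -> 0 < rho ->
  exists M, forall s : nat -> R, exists i j,
    [/\ (i < j)%N, (j <= M)%N & exists q : int, `|s j - s i - q%:~R * p| < rho].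
Proof.
move=> p0 rho0.
pose M := Num.truncn (p / rho); have M1p : p < M.+1%:R * rho.
  have /andP[_] := truncn_itv (ltW (divr_gt0 p0 rho0)).
  by rewrite ltr_pdivrMr.
exists M.+1 => s.
pose fl i : int := Num.floor (s i / p); pose fr i := s i / p - (fl i)%:~R.
have fr_itv i : 0 <= fr i < 1.
  have /andP[h1 h2] := floor_itv (s i / p).
  by rewrite /fr subr_ge0 h1 /= ltrBlDr addrC; move: h2; rewrite intrD.
pose box i := Num.truncn (M.+1%:R * fr i).
have box_lt i : (box i < M.+1)%N.
  have /andP[f0 f1] := fr_itv i.
  by rewrite ltnS /box truncn_le_nat -[ltRHS]mulr1 ltr_pM2l.
have : ~ injective (fun i : 'I_M.+2 => Ordinal (box_lt i)).
  by move=> /leq_card; rewrite !card_ord ltnn.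
have same_box i j : box i = box j ->
    `|s j - s i - (fl j - fl i)%:~R * p| < rho.
  move=> bij; have M0 : 0 < M.+1%:R :> R by [].
  have /andP[i0 i1] := fr_itv i; have /andP[j0 j1] := fr_itv j.
  have /andP[bi bi'] := truncn_itv (mulr_ge0 (ltW M0) i0).
  have /andP[bj bj'] := truncn_itv (mulr_ge0 (ltW M0) j0).
  rewrite -/(box i) -/(box j) bij -natr1 in bi bi' bj bj'.
  have -> : s j - s i - (fl j - fl i)%:~R * p = (fr j - fr i) * p.
    by rewrite /fr intrB !mulrBl !divfK ?gt_eqF//; lra.
  rewrite normrM (gtr0_norm p0) -(ltr_pM2l M0) mulrA.
  apply: (@lt_trans _ _ (1 * p)); last by rewrite mul1r.
  rewrite ltr_pM2r// -[X in X * _](gtr0_norm M0) -normrM mulrBr ltr_norml.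
  by apply/andP; split; lra.
move=> /existsNP[i] /existsNP[j] /not_implyP[] /(congr1 val)/= bij /eqP ij.
have ijn : nat_of_ord i != j by apply: contra ij => /eqP /ord_inj ->.
have [lt|lt|/eqP] := ltngtP i j; last by rewrite (negbTE ijn).
- exists i, j; split=> //; first by rewrite -ltnS.
  by exists (fl j - fl i); exact: same_box.
- exists j, i; split=> //; first by rewrite -ltnS.
  by exists (fl i - fl j); apply: same_box.
Qed.

(** * Return times of recurrent points *)

Section Recurrence.
Context {R : realType} {X : completeNormedModType R} (Phi : R -> X -> X).
Hypothesis flow : continuous_semiflow Phi.

Lemma semiflow0 x : Phi 0 x = x.
Proof. by case: flow. Qed.

Lemma semiflowD t s x : 0 <= t -> 0 <= s -> Phi t (Phi s x) = Phi (t + s) x.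
Proof. by case: flow => _ _ h t0 s0; exact: h. Qed.

Lemma semiflow_cvg (p : R * X) : 0 <= p.1 ->
  (fun q => Phi q.1 q.2) @ within [set q : R * X | 0 <= q.1] (nbhs p) -->
  Phi p.1 p.2.
Proof. by case: flow => /subspace_continuousP h _ _; exact: h. Qed.

Lemma semiflow_continuous t : 0 <= t -> continuous (Phi t).
Proof.
move=> t0 x; move: (@semiflow_cvg (t, x) t0) => /= h; apply: (cvg_trans _ h) => {h}.
move=> A /= [[U V] /= [Ut Vx] UVA]; apply: filterS Vx => y Vy.
by apply: (UVA (t, y)) => //=; split => //; exact: nbhs_singleton.
Qed.

Lemma orbit_continuous x : {within [set t : R | 0 <= t], continuous (Phi ^~ x)}.
Proof.
apply/subspace_continuousP => t /= t0; move: (@semiflow_cvg (t, x) t0) => /= h.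
apply: (cvg_trans _ h) => {h}.
move=> A /= [[U V] /= [Ut Vx] UVA]; apply: filterS Ut => s Us s0.
by apply: (UVA (s, x)) => //=; split => //; exact: nbhs_singleton.
Qed.

Lemma small_time_displacement (z : X) (e : R) : 0 < e ->
  \forall z' \near z & h \near (0 : R), 0 <= h -> `|Phi h z' - z'| < e.
Proof.
move=> e0; have e20 : 0 < e / 2 by rewrite divr_gt0.
have := @semiflow_cvg (0, z) (lexx _); rewrite semiflow0.
move=> /(_ _ (nbhsx_ballx z _ e20)).
case=> [[U V] /= [U0 Vz] UVA]; exists ((V `&` ball z (e / 2)), U) => /=.
  by split => //; apply: filterI => //; exact: nbhsx_ballx.
move=> [z' h] /= [[Vz' bz'] Uh] h0.
have := UVA (h, z') (conj Uh Vz') h0; rewrite /= -ball_normE /= => b1.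
move: bz'; rewrite -ball_normE /= => b2.
rewrite -(subrKA z); apply: (le_lt_trans (ler_normD _ _)).
by rewrite [ltRHS]splitr ltrD // distrC.
Qed.

Lemma recurrent_return x t (e : R) : recurrent Phi x -> 0 < e ->
  exists2 s : R, t <= s & 0 <= s /\ `|Phi s x - x| < e.
Proof.
move=> rx e0; have m0 : 0 <= Num.max 0 t by rewrite le_max lexx.
have [_ [[s /= ms ->] +]] := rx _ m0 _ (nbhsx_ballx x e e0).
rewrite -ball_normE /= distrC => ?; exists s.
  by apply: le_trans ms; rewrite le_max lexx orbT.
by split=> //; apply: le_trans ms.
Qed.

Lemma recurrent_near x t (A : set X) : recurrent Phi x -> nbhs x A ->
  exists2 s : R, t <= s & 0 <= s /\ A (Phi s x).
Proof.
move=> rx /nbhs_ballP[e /= e0 eA].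
have [s ts [s0 ds]] := recurrent_return t rx e0.
exists s => //; split => //; apply: eA.
by rewrite -ball_normE /= distrC.
Qed.

Lemma recurrent_semiflow t x : 0 <= t -> recurrent Phi x ->
  recurrent Phi (Phi t x).
Proof.
move=> t0 rx r /= r0 A /(semiflow_continuous t0 (x := x)) /= Ax.
have [s ts [s0 As]] := recurrent_near r rx Ax.
exists (Phi s (Phi t x)); split; last by rewrite semiflowD // addrC -semiflowD.
by exists s.
Qed.

Lemma birkhoff_center_semiflow t x : 0 <= t -> birkhoff_center Phi x ->
  birkhoff_center Phi (Phi t x).
Proof.
move=> t0 bx A /(semiflow_continuous t0 (x := x)) /bx [y [/= ry Ay]].
by exists (Phi t y); split => //; exact: recurrent_semiflow.
Qed.

(* Sums of consecutive return times are again return times: the next return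
   time is chosen after all the previous ones. *)
Lemma return_time_differences y (p e : R) m : 0 <= p -> 0 < e ->
  recurrent Phi y -> exists s : nat -> R, forall i j, (i < j)%N -> (j <= m)%N ->
    p <= s j - s i /\ `|Phi (s j - s i) y - y| < e.
Proof.
move=> p0 e0 ry; elim: m => [|m [s hs]].
  by exists (fun=> 0) => i j ij; rewrite leqn0 => /eqP j0; rewrite j0 in ij.
have sm i : (i <= m)%N -> 0 <= s m - s i /\ `|Phi (s m - s i) y - y| < e.
  rewrite leq_eqVlt => /orP[/eqP->|im].
    by rewrite subrr semiflow0 subrr normr0.
  by have [h1 h2] := hs _ _ im (leqnn m); split => //; exact: le_trans h1.
(* These are finitely many open conditions at [y]. A late return of [y] at time [r] satisfying them
   makes every [s m - s i + r] a return time. *)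
have : \forall z \near y, forall i : 'I_m.+1, `|Phi (s m - s i) z - y| < e.
  apply: filter_forall => i; have [d0 de] := sm i (ltn_ord i).
  have gap0 : 0 < e - `|Phi (s m - s i) y - y| by rewrite subr_gt0.
  have /cvgr_dist_lt/(_ _ gap0) := semiflow_continuous d0 (x := y).
  apply: filterS => z; rewrite ltrBrDr distrC; apply: le_lt_trans.
  by rewrite -(subrKA (Phi (s m - s i) y) (Phi (s m - s i) z) (- y)) ler_normD.
move=> /(recurrent_near p ry)[r pr [r0 Ar]].
exists (fun j => if (j <= m)%N then s j else s m + r) => i j ij.
rewrite leq_eqVlt => /orP[/eqP jm|]; last first.
  rewrite ltnS => jm; rewrite jm (leq_trans (ltnW ij) jm); exact: hs.
have im : (i <= m)%N by rewrite -ltnS -jm.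
have [d0 _] := sm i im.
rewrite im jm ltnn addrAC; split; first by rewrite (le_trans pr) // lerDr.
by rewrite -semiflowD //; exact: (Ar (Ordinal (im : (i < m.+1)%N))).
Qed.

(** * Compactness and invariance of the Birkhoff center *)

Section Attractor.
Context (Gamma : set X).
Hypothesis attr : global_attractor Phi Gamma.

Lemma attractor_compact : compact Gamma.
Proof. by case: attr. Qed.

Lemma attractor_semiflow t x : 0 <= t -> Gamma x -> Gamma (Phi t x).
Proof. by case: attr => _ _ inv _ t0 Gx; rewrite -(inv _ t0); exists x. Qed.

Lemma attractor_near x (e : R) : 0 < e ->
  \forall t \near +oo, exists2 b, Gamma b & `|Phi t x - b| < e.
Proof.
move=> e0; have h : ereal_sup [set ereal_inf [set (`|a - b|)%:E | b in Gamma]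
    | a in Phi t @` [set x]] @[t --> +oo] --> 0%:E.
  case: attr => _ _ _; apply; first by exists x.
  by exists `|x|; split; [exact: num_real|move=> M xM _ ->; exact: ltW].
near=> t.
suff : (ereal_inf [set (`|Phi t x - b|)%:E | b in Gamma] < e%:E)%E.
  by move/ereal_inf_lt => [_ [b Gb <-]]; rewrite lte_fin; exists b.
apply: (@le_lt_trans _ _ (ereal_sup [set ereal_inf [set (`|a - b|)%:E | b in Gamma]
                  | a in Phi t @` [set x]])).
  by apply: ereal_sup_ubound; exists (Phi t x) => //; exists x.
near: t.
have : nbhs (0%:E : \bar R) [set y | (y < e%:E)%E].
  by apply: open_nbhs_nbhs; split; [exact: open_ereal_lt_ereal|rewrite /= lte_fin].
by move/h.
Unshelve. all: by end_near. Qed.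

(** Arbitrarily late returns to [x] are also close to [Gamma], which is closed. *)
Lemma recurrent_attractor x : recurrent Phi x -> Gamma x.
Proof.
move=> rx; have clG : closed Gamma.
  by apply: compact_closed attractor_compact; exact: norm_hausdorff.
apply: clG => A /nbhs_ballP[e /= e0 eA].
have e20 : 0 < e / 2 by rewrite divr_gt0.
have [M [_ hM]] := attractor_near x e20.
have [s Ms [s0 ds]] := recurrent_return (M + 1) rx e20.
have [|b Gb db] := hM s; first by rewrite (lt_le_trans _ Ms) // ltrDl.
exists b; split => //; apply: eA; rewrite -ball_normE /=.
rewrite -(subrKA (Phi s x)); apply: (le_lt_trans (ler_normD _ _)).
by rewrite [ltRHS]splitr ltrD // distrC.
Qed.

Lemma birkhoff_center_attractor : birkhoff_center Phi `<=` Gamma.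
Proof.
have clG : closed Gamma.
  by apply: compact_closed attractor_compact; exact: norm_hausdorff.
rewrite [X in _ `<=` X](closure_id Gamma).1 //.
by apply: closureS => x; exact: recurrent_attractor.
Qed.

Lemma birkhoff_center_compact : compact (birkhoff_center Phi).
Proof.
exact: subclosed_compact (@closed_closure _ _) attractor_compact
  birkhoff_center_attractor.
Qed.

(** A recurrent point [z] is a limit of points [Phi r z = Phi s (Phi (r - s) z)], and the image of
    the compact center under [Phi s] is closed. *)
Lemma birkhoff_center_preimage s x : 0 <= s -> birkhoff_center Phi x ->
  exists2 y, birkhoff_center Phi y & Phi s y = x.
Proof.
move=> s0; suff : birkhoff_center Phi `<=` Phi s @` birkhoff_center Phi.
  by move=> /[apply] -[y]; exists y.
have clI : closed (Phi s @` birkhoff_center Phi).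
  apply: compact_closed; first exact: norm_hausdorff.
  apply: continuous_compact; last exact: birkhoff_center_compact.
  by apply: continuous_subspaceT; exact: semiflow_continuous.
rewrite [X in _ `<=` X](closure_id _).1 //.
(* A second closure on the right reduces the goal to recurrent points, which need only be limits of
   images. *)
rewrite [X in _ `<=` X](closure_id _).1; last exact: closed_closure.
apply: closureS => z rz A Az.
have [r sr [r0 Ar]] := recurrent_near s rz Az.
exists (Phi r z); split => //; exists (Phi (r - s) z).
  by apply: subset_closure; apply: recurrent_semiflow => //; rewrite subr_ge0.
by rewrite semiflowD ?subr_ge0// addrC subrK.
Qed.

Lemma uniform_small_time_displacement (e : R) : 0 < e ->
  exists2 rho : R, 0 < rho & forall z (h : R), Gamma z -> 0 <= h -> h < rho ->
    `|Phi h z - z| < e.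
Proof.
move=> e0.
have /compact_near_coveringP cov := attractor_compact.
have [|rho /= rho0 hrho] := cov _ (nbhs (0 : R))
  (fun h z => 0 <= h -> `|Phi h z - z| < e) _.
  by move=> z _; exact: small_time_displacement.
exists rho => // z h Gz h0 hr.
by apply: hrho => //=; rewrite sub0r normrN ger0_norm.
Qed.

(** Recurrence passes to the time-[p] map: some difference of return times is itself a return time
    and almost a multiple of [p], and the small discrepancy in time moves points of [Gamma]
    little. *)
Lemma recurrent_multiples y (p e : R) : 0 < p -> 0 < e -> recurrent Phi y ->
  exists2 k, (0 < k)%N & `|Phi (k%:R * p) y - y| < e.
Proof.
move=> p0 e0 ry; have e20 : 0 < e / 2 by rewrite divr_gt0.
have [rho rho0 small] := uniform_small_time_displacement e20.
(* Closeness within [p] to some [r >= p] makes the multiple positive; closeness within [rho] bounds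
   the displacement. *)
have min0 : 0 < Num.min p rho by rewrite lt_min p0.
have [M boxes] := pigeonhole_mod p0 min0.
have [s ret] := return_time_differences M (ltW p0) e20 ry.
have [i [j [ij jM [q]]]] := boxes s; have [pr near_y] := ret i j ij jM.
rewrite lt_min => /andP[]; set r := s j - s i in pr near_y *; clearbody r.
rewrite ltr_norml => /andP[_ rp]; rewrite ltr_norml => /andP[rr1 rr2].
have : 0 < q%:~R * p :> R by lra.
rewrite pmulr_lgt0 // ltr0z; case: q rp rr1 rr2 => [k|] // rp rr1 rr2 k0.
exists k => //; have r0 : 0 <= r by exact: le_trans (ltW p0) pr.
have Gy := recurrent_attractor ry.
have kp0 : 0 <= k%:R * p by rewrite mulr_ge0 // ltW.
rewrite -pmulrn in rp rr1 rr2.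
rewrite -(subrKA (Phi r y)) (le_lt_trans (ler_normD _ _)) //.
rewrite [ltRHS]splitr ltrD //.
have [le|lt] := leP r (k%:R * p).
  rewrite -(subrK r (k%:R * p)) -semiflowD ?subr_ge0 //.
  by apply: small; rewrite ?subr_ge0 //; [exact: attractor_semiflow|lra].
rewrite distrC -(subrK (k%:R * p) r) -semiflowD ?subr_ge0 //; last exact: ltW.
by apply: small; rewrite ?subr_ge0 ?(ltW lt) //; exact: attractor_semiflow.
Qed.

(** * Orbit differences and a single cone *)

Section Cone.
Context (C : set X).
Hypotheses (C_closed : closed C) (C_scale : forall v (l : R), C v -> C (l *: v)).

(** A small multiple of [v] lies in the neighbourhood of [0], and scaling back stays in [C]. This
    isolates the degenerate case where [C] is the whole space. *)
Lemma cone_interior0 v : interior C 0 -> C v.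
Proof.
move=> C0; have l0 : (l *: v) @[l --> (0 : R)] --> (0 : X).
  by rewrite -[X in _ --> X](scale0r v); apply: cvgZr_tmp; exact: cvg_id.
have /nbhs_ballP[e /= e0 eC] := l0 _ C0.
have e20 : 0 < e / 2 by rewrite divr_gt0.
have : C ((e / 2) *: v).
  apply: eC; rewrite -ball_normE /= sub0r normrN gtr0_norm //.
  by rewrite ltr_pdivrMr // ltr_pMr // ltr1n.
move/(C_scale ((e / 2)^-1)); rewrite scalerA mulVf ?scale1r //.
by rewrite gt_eqF.
Qed.

Context (T : R).
Hypotheses (T0 : 0 < T) (C_positive : forall x y, (C `\ 0) (x - y) ->
  forall t, T <= t -> interior C (Phi t x - Phi t y)).

(** By compactness it suffices to argue near one pair [(a, b)]. Either [a - b] is outside the closed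
    set [C], or the images are closer than [d], and both persist nearby; or strong positivity leaves
    room inside [C]. *)
Lemma cone_margin (d : R) : 0 < d ->
  exists2 e : R, 0 < e & forall a b v, Gamma a -> Gamma b -> C (a - b) ->
    d <= `|Phi T a - Phi T b| -> `|v| < e -> C (Phi T a - Phi T b + v).
Proof.
move=> d0; have G2 : compact (Gamma `*` Gamma).
  by apply: compact_setX; exact: attractor_compact.
pose P (v : X) (p : X * X) := C (p.1 - p.2) ->
  d <= `|Phi T p.1 - Phi T p.2| -> C (Phi T p.1 - Phi T p.2 + v).
have Tc := semiflow_continuous (ltW T0).
have /compact_near_coveringP cov := G2.
suff cover x : (Gamma `*` Gamma) x ->
    \forall x' \near x & v \near (0 : X), P v x'.
  have : nbhs (0 : X) (fun v => Gamma `*` Gamma `<=` P v).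
    exact: (cov _ (nbhs (0 : X)) P _ cover).
  move=> /nbhs_ballP[e /= e0 he].
  exists e => // a b v Ga Gb Cab dab ve.
  by apply: (he v _ (a, b)) => //=; rewrite -ball_normE /= sub0r normrN.
case: x => a b _; pose q0 : (X * X) * X := ((a, b), 0).
suff : \forall q \near q0, P q.2 q.1 by [].
have c1 : q.1.1 @[q --> q0] --> a.
  by apply: (cvg_comp _ _ (@cvg_fst _ _ _ _ _)); exact: cvg_fst.
have c2 : q.1.2 @[q --> q0] --> b.
  by apply: (cvg_comp _ _ (@cvg_fst _ _ _ _ _)); exact: cvg_snd.
have c3 : q.2 @[q --> q0] --> (0 : X) by exact: cvg_snd.
have d1 : Phi T q.1.1 @[q --> q0] --> Phi T a by apply: cvg_comp c1 (Tc a).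
have d2 : Phi T q.1.2 @[q --> q0] --> Phi T b by apply: cvg_comp c2 (Tc b).
have [Cab|nCab] := pselect (C (a - b)); last first.
  have nb : nbhs (a - b) (~` C).
    by apply: open_nbhs_nbhs; split => //; exact: closed_openC.
  have cv : (q.1.1 - q.1.2) @[q --> q0] --> a - b by exact: cvgB.
  have : \forall q \near q0, ~ C (q.1.1 - q.1.2) by exact: (cv _ nb).
  by apply: filterS => q nC /nC.
have d12 : (Phi T q.1.1 - Phi T q.1.2) @[q --> q0] --> Phi T a - Phi T b.
  exact: cvgB.
have [dab|nd] := ltP `|Phi T a - Phi T b| d.
  have /cvgr_norm_lt/(_ _ dab) := d12.
  by apply: filterS => q lt _; rewrite leNgt lt.
have ab0 : (C `\ 0) (a - b).
  split => // /eqP; rewrite subr_eq0 => /eqP ab.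
  by move: nd; rewrite ab subrr normr0 leNgt d0.
have cv : (Phi T q.1.1 - Phi T q.1.2 + q.2) @[q --> q0] --> Phi T a - Phi T b.
  by rewrite -[X in _ --> X]addr0; exact: cvgD.
have : \forall q \near q0, C (Phi T q.1.1 - Phi T q.1.2 + q.2).
  exact: (cv _ (C_positive ab0 (lexx T))).
by apply: filterS => q Cq _ _.
Qed.

Section Proper.
Hypothesis C_proper : ~ interior C 0.

(** By [C_proper] a difference interior to [C] is nonzero, so strong positivity can be applied
    again. *)
Lemma cone_persist x y s t : 0 <= s -> s + T <= t ->
  (C `\ 0) (Phi s x - Phi s y) -> (C `\ 0) (Phi t x - Phi t y).
Proof.
move=> s0 st Cs; have Tts : T <= t - s by rewrite lerBrDl.
have ts0 : 0 <= t - s by rewrite (le_trans _ Tts) // ltW.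
have := C_positive Cs Tts; rewrite !semiflowD // subrK => iC; split.
  exact: interior_subset.
by move=> z0; apply: C_proper; rewrite -z0.
Qed.

(* The pair (x, Phi r x) is jointly recurrent. *)
Lemma cone_orbit_pair x r s : recurrent Phi x -> 0 <= r -> 0 <= s ->
  (C `\ 0) (Phi s (Phi r x) - Phi s x) -> C (Phi r x - x).
Proof.
move=> rx r0 s0 Cs; apply: contrapT => nC.
have cv : (Phi r z - z) @[z --> x] --> Phi r x - x.
  by apply: cvgB; [exact: semiflow_continuous|exact: cvg_id].
have nb : nbhs (Phi r x - x) (~` C).
  by apply: open_nbhs_nbhs; split => //; exact: closed_openC.
have [t st [t0 nCt]] := recurrent_near (s + T) rx (cv _ nb).
apply: nCt; have [] := cone_persist s0 st Cs.
by rewrite [Phi t (Phi r x)]semiflowD // [t + r]addrC -semiflowD.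
Qed.

(* With n a return time of x, pushing forward (x, Phi (k n) y) by n keeps it
   in C even after moving its first point back to x, since the pair stays away
   from the diagonal; then k n is taken to be a return time of y. *)
Lemma cone_separated_pair x y s (d : R) : recurrent Phi x -> recurrent Phi y ->
  0 <= s -> 0 < d -> (forall r : R, 0 <= r -> d <= `|x - Phi r y|) ->
  (C `\ 0) (Phi s x - Phi s y) -> C (x - y).
Proof.
move=> rx ry s0 d0 sep Cs; have d20 : 0 < d / 2 by rewrite divr_gt0.
have Gx := recurrent_attractor rx; have Gy := recurrent_attractor ry.
have [e e0 margin] := cone_margin d20.
(* [e] keeps the move from [Phi n x] to [x] within the margin; [d / 2] keeps [Phi n x] at distance
   at least [d / 2] from the orbit of [y]. *)
have min0 : 0 < Num.min e (d / 2) by rewrite lt_min e0.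
(* One [T] carries the cone condition from time [s] to [n - T], the other is the final stretch to
   which the margin applies. *)
have [n sn [n0]] := recurrent_return (s + T + T) rx min0.
rewrite lt_min => /andP[ne nd].
have nT : T <= n - T by rewrite lerBrDr (le_trans _ sn) // -addrA lerDr.
have nT0 : 0 <= n - T by rewrite (le_trans _ nT) // ltW.
have n_gt0 : 0 < n by rewrite (lt_le_trans T0) // (le_trans nT) // gerBl ltW.
have close_up r : 0 <= r -> C (Phi (n - T) x - Phi (n - T) (Phi r y)) ->
    C (x - Phi (n + r) y).
  move=> r0 Cr; have T0w := ltW T0.
  have := margin _ _ (x - Phi n x) (attractor_semiflow nT0 Gx)
    (attractor_semiflow nT0 (attractor_semiflow r0 Gy)) Cr.
  have -> : Phi T (Phi (n - T) x) = Phi n x.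
    by rewrite semiflowD // addrC subrK.
  have -> : Phi T (Phi (n - T) (Phi r y)) = Phi (n + r) y.
    by rewrite (semiflowD (Phi r y) T0w nT0) [T + _]addrC subrK semiflowD.
  have -> : Phi n x - Phi (n + r) y + (x - Phi n x) = x - Phi (n + r) y.
    by rewrite addrC subrKA.
  apply; last by rewrite distrC.
  have := sep (n + r) (addr_ge0 n0 r0).
  rewrite -(subrKA (Phi n x) x).
  have := ler_normD (x - Phi n x) (Phi n x - Phi (n + r) y).
  by rewrite [`|x - Phi n x|]distrC; lra.
(* The multiples start at 1: the first step draws on the cone condition at time [s], as [x - y] is
   not yet known to be in [C]. *)
have loop k : C (x - Phi (k.+1%:R * n) y).
  elim: k => [|k IH].
    rewrite mul1r -[n in Phi n y]addr0; apply: close_up => //.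
    rewrite semiflow0; have [|] := @cone_persist x y s (n - T) s0 _ Cs => //.
    by rewrite lerBrDr.
  have k0 : 0 <= k.+1%:R * n by rewrite mulr_ge0.
  rewrite -natr1 mulrDl mul1r [_ + n]addrC; apply: close_up => //.
  apply: interior_subset; apply: C_positive => //; split => // z0.
  by have := sep _ k0; rewrite z0 normr0 leNgt d0.
apply: contrapT => nC.
have cv : (x - z) @[z --> y] --> x - y.
  by apply: cvgB; [exact: cvg_cst|exact: cvg_id].
have nb : nbhs (x - y) (~` C).
  by apply: open_nbhs_nbhs; split => //; exact: closed_openC.
have /nbhs_ballP[r /= r0 nCr] := cv _ nb.
have [[|k] // _ kr] := recurrent_multiples n_gt0 r0 ry.
by apply: (nCr _ _ (loop k)); rewrite -ball_normE /= distrC.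
Qed.

Lemma birkhoff_center_cone_backward a b t :
  birkhoff_center Phi a -> birkhoff_center Phi b -> 0 <= t ->
  (C `\ 0) (Phi t a - Phi t b) -> C (a - b).
Proof.
(* The extra [T] turns membership in [C] into the open condition of lying in its interior. *)
move=> ba bb t0 Ct; apply: contrapT => nC; pose s := t + T.
have s0 : 0 <= s by rewrite addr_ge0 // ltW.
have Cs : interior C (Phi s a - Phi s b).
  by have := C_positive Ct (lexx T); rewrite !semiflowD ?(ltW T0) // [T + t]addrC.
have c1 : p.1 @[p --> (a, b)] --> a by exact: cvg_fst.
have c2 : p.2 @[p --> (a, b)] --> b by exact: cvg_snd.
have cv : (p.1 - p.2) @[p --> (a, b)] --> a - b by exact: cvgB.
have cvs : (Phi s p.1 - Phi s p.2) @[p --> (a, b)] --> Phi s a - Phi s b.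
  by apply: cvgB; [apply: cvg_comp c1 _|apply: cvg_comp c2 _];
    exact: semiflow_continuous.
have nb : nbhs (a - b) (~` C).
  by apply: open_nbhs_nbhs; split => //; exact: closed_openC.
have : \forall p \near (a, b),
    ~ C (p.1 - p.2) /\ interior C (Phi s p.1 - Phi s p.2).
  by apply: filterI; [exact: (cv _ nb)|exact: (cvs _ (nbhs_interior Cs))].
move=> [[U V] /= [Ua Vb] UV].
(* Taking [x] in the interior of [U] leaves a ball around it inside [U]; its radius is the
   separation [d] if the orbit of [y] avoids [U]. *)
have [x [/= rx Ux]] := ba _ (nbhs_interior Ua).
have [y [/= ry Vy]] := bb _ Vb.
have Cpair x' y' : U x' -> V y' ->
    ~ C (x' - y') /\ (C `\ 0) (Phi s x' - Phi s y').
  move=> Ux' Vy'; have [h1 h2] := UV (x', y') (conj Ux' Vy').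
  split => //; split; first exact: interior_subset.
  by move=> z0; apply: C_proper; rewrite -z0.
have [[r [r0 Ur]]|noU] := pselect (exists r, 0 <= r /\ U (Phi r y)).
  have [nCr Cr] := Cpair _ _ Ur Vy.
  by apply: nCr; exact: cone_orbit_pair Cr.
have [d /= d0 dU] := (nbhs_ballP _ _).1 Ux.
have [nCxy Cxy] := Cpair _ _ (interior_subset Ux) Vy.
apply: nCxy; apply: cone_separated_pair d0 _ Cxy => // r r0.
rewrite leNgt; apply/negP => lt; apply: noU; exists r; split => //.
by apply: dU; rewrite -ball_normE.
Qed.

End Proper.

(** Membership in [C] at time [t] would persist to time [t + T + s], which is a forward time of
    [(x, y)], and then pass back to [x - y]. *)
Lemma cone_notin_orbit x y x' y' s t : birkhoff_center Phi x ->
  birkhoff_center Phi y -> 0 <= s -> Phi s x' = x -> Phi s y' = y ->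
  ~ C (x - y) -> 0 <= t -> ~ (C `\ 0) (Phi t x' - Phi t y').
Proof.
move=> bx by_ s0 xs ys nC t0 Ct; have C_proper : ~ interior C 0.
  by move/cone_interior0.
have stT : t + T <= t + T + s by rewrite lerDl.
have tT0 : 0 <= t + T by rewrite addr_ge0 // ltW.
have := cone_persist C_proper t0 stT Ct.
rewrite -!(semiflowD _ tT0 s0) xs ys => Cts; apply: nC.
exact: (birkhoff_center_cone_backward C_proper bx by_ tT0 Cts).
Qed.

(** Membership is pushed forward beyond both [s] and [t], then pulled back to time [t]. *)
Lemma cone_in_orbit x' y' s t : birkhoff_center Phi x' ->
  birkhoff_center Phi y' -> 0 <= s -> (C `\ 0) (Phi s x' - Phi s y') ->
  0 <= t -> C (Phi t x' - Phi t y').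
Proof.
move=> bx by_ s0 Cs t0.
have [/cone_interior0//|C_proper] := pselect (interior C 0).
have stT : s + T <= s + T + t by rewrite lerDl.
have sT0 : 0 <= s + T by rewrite addr_ge0 // ltW.
have := cone_persist C_proper s0 stT Cs.
rewrite -!(semiflowD _ sT0 t0) => Cts.
apply: (birkhoff_center_cone_backward C_proper _ _ sT0 Cts);
  exact: birkhoff_center_semiflow.
Qed.

End Cone.

(** * The level of a pair in the nested cones *)

(** The level is the least finite index whose cone contains [x - y], or infinity if there is none.
    Any preimages in the center will do as [x'] and [y']. *)
Lemma birkhoff_center_NICs_level (N : xnat) (C : xnat -> set X) x y :
  NICs Phi N C -> UESM_NICs Phi N C ->
  birkhoff_center Phi x -> birkhoff_center Phi y -> x <> y ->
  exists i, [/\ xnat_le (Some 1%N) i, xnat_le i N &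
   forall s : R, 0 < s -> exists x' y',
     [/\ birkhoff_center Phi x', birkhoff_center Phi y',
         Phi s x' = x, Phi s y' = y &
         forall t : R, 0 <= t ->
           ((C i `\` pred_cone C i) `|` [set 0]) (Phi t x' - Phi t y')]].
Proof.
move=> nics uesm bx by_ xy.
have C0 z : C (Some 0%N) z -> z = 0 by rewrite (nics_bottom nics).
have cone n : (0 < n)%N -> xnat_lt (Some n) N -> [/\ closed (C (Some n)),
    forall v (l : R), C (Some n) v -> C (Some n) (l *: v) &
    UESM Phi (C (Some n))].
  move=> n0 nN; have [k [kc _]] := nics_cones nics.
  by have [[? ? _ _] _] := kc _ n0 nN; split => //; exact: uesm.
have below n x' y' s t : 0 <= s -> Phi s x' = x -> Phi s y' = y -> 0 <= t ->
    xnat_lt (Some n) N -> ~ C (Some n) (x - y) ->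
    Phi t x' - Phi t y' <> 0 -> ~ C (Some n) (Phi t x' - Phi t y').
  (* Index 0 is treated apart, since the cone lemmas are available only from index 1 on. *)
  case: n => [|n] s0 xs ys t0 nN nC z0 Cz; first exact/z0/C0.
  have [clC scC [T T0 posC]] := cone _ (ltn0Sn n) nN.
  by apply: (cone_notin_orbit clC scC T0 posC bx by_ s0 xs ys nC t0); split.
have [[n0 [n0N Cn0]]|noC] :=
    pselect (exists n, xnat_le (Some n) N /\ C (Some n) (x - y)).
  have ex : exists n, `[< xnat_le (Some n) N /\ C (Some n) (x - y) >].
    by exists n0; apply/asboolP.
  have [[|n] /asboolP[nN Cn] nmin] := ex_minnP ex.
    by case: xy; apply/eqP; rewrite -subr_eq0; apply/eqP/C0.
  have nltN : xnat_lt (Some n) N.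
    by move: nN; case: (N) => [m|] //=; rewrite /xnat_lt /= -ltnNge.
  have nCn : ~ C (Some n) (x - y).
    move=> Cn'; suff : (n.+1 <= n)%N by rewrite ltnn.
    apply: nmin; apply/asboolP; split => //.
    by move: nN; case: (N) => [m|] //= /ltnW.
  exists (Some n.+1); split => // s s_gt0; have s0 := ltW s_gt0.
  have [x' bx' xs] := birkhoff_center_preimage s0 bx.
  have [y' by' ys] := birkhoff_center_preimage s0 by_.
  exists x', y'; split => // t t0.
  have [z0|z0] := pselect (Phi t x' - Phi t y' = 0); [by right|left].
  split; last exact: below xs ys _ _ _ _.
  (* Below [N] the cone lemma applies; otherwise [n + 1 = N] and the cone is the whole space. *)
  have [nSN|] := boolP (xnat_lt (Some n.+1) N).
    have [clC scC [T T0 posC]] := cone _ (ltn0Sn n) nSN.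
    apply: (cone_in_orbit clC scC T0 posC bx' by' s0) => //.
    rewrite xs ys; split => // xy0; apply: xy; apply/eqP.
    by rewrite -subr_eq0; exact/eqP.
  rewrite /xnat_lt negbK => leN.
  have <- : N = Some n.+1.
    by move: nN leN; case: (N) => [m|] //= *; congr Some; apply/anti_leq/andP.
  by rewrite (nics_top nics).
(* A finite [N] would itself be a level, because [C N] is everything. *)
have N_oo : N = None.
  case eN : N => [m|] //; case: noC; exists m; rewrite eN /=; split => //.
  by rewrite -eN (nics_top nics).
exists None; rewrite N_oo; split => // s s_gt0; have s0 := ltW s_gt0.
have [x' bx' xs] := birkhoff_center_preimage s0 bx.
have [y' by' ys] := birkhoff_center_preimage s0 by_.
exists x', y'; split => // t t0.
have [z0|z0] := pselect (Phi t x' - Phi t y' = 0); [by right|left].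
split; first by rewrite -[None]N_oo (nics_top nics).
move=> [n _]; apply: below s0 xs ys t0 _ _ z0; rewrite ?N_oo // => Cn.
by apply: noC; exists n; rewrite N_oo.
Qed.

(** * Invariance of the components *)

(** The orbit segment from [x] to [Phi t x] is connected and stays in the center. *)
Lemma connected_component_semiflow (t : R) x : 0 <= t -> birkhoff_center Phi x ->
  connected_component (birkhoff_center Phi) x (Phi t x).
Proof.
move=> t0 bx.
have orbit_sub : Phi^~ x @` `[0, t] `<=` birkhoff_center Phi.
  move=> _ [s /= + <-]; rewrite in_itv /= => /andP[s0 _].
  exact: birkhoff_center_semiflow.
have nonneg : `[0, t]%classic `<=` [set s : R | 0 <= s].
  by move=> s /=; rewrite in_itv /= => /andP[].
have orbit_cont := continuous_subspaceW nonneg (@orbit_continuous x).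
have orbit_conn :=
  connected_continuous_connected (@segment_connected _ 0 t) orbit_cont.
have orbit_x : (Phi^~ x @` `[0, t]) x.
  by exists 0; [rewrite /= in_itv /= lexx|exact: semiflow0].
apply: (connected_component_max orbit_x orbit_sub orbit_conn).
by exists t => //; rewrite /= in_itv /= t0 lexx.
Qed.

(** For surjectivity, a preimage in the center is joined to its image by an orbit segment, hence
    lies in the same component. *)
Lemma birkhoff_component_invariant b :
  invariant_set Phi (connected_component (birkhoff_center Phi) b).
Proof.
move=> t t0; apply/seteqP; split=> [_ [x Bx <-]|x Bx].
  apply: (connected_component_trans Bx); apply: connected_component_semiflow => //.
  exact: connected_component_sub Bx.
have [y by_ yx] := birkhoff_center_preimage t0 (connected_component_sub Bx).
exists y => //; apply: (connected_component_trans Bx).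
apply: connected_component_sym; rewrite -yx.
exact: connected_component_semiflow.
Qed.

End Attractor.
End Recurrence.

(** * Coordinates modulo a subspace and embedding into Euclidean space *)

(* On the compact unit sphere of the complement spanned by e, vectors stay at
   a positive distance from Pi; this bounds the coordinates along e. *)
Lemma codimension_coordinates {R : realType} {X : normedModType R}
    (Pi : set X) d : closed Pi -> linear_subspace Pi -> codimension_is Pi d ->
  exists2 c : X -> 'rV[R]_d, continuous c &
    forall x y, c x = c y -> Pi (x - y).
Proof.
move=> Pi_closed [Pi0 Pi_lin] [e [e_free e_gen]].
have PiD a u v : Pi u -> Pi v -> Pi (a *: u + v).
  by move=> /mem_set hu /mem_set hv; apply/set_mem; exact: Pi_lin.
have PiB u v : Pi u -> Pi v -> Pi (u - v).
  by move=> hu hv; rewrite addrC -scaleN1r; exact: PiD.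
pose F (v : 'rV[R]_d) := \sum_(j < d) v 0 j *: e j.
have FB u v : F (u - v) = F u - F v.
  by rewrite /F -sumrB; apply: eq_bigr => j _; rewrite !mxE scalerBl.
have FZ a v : F (a *: v) = a *: F v.
  by rewrite /F scaler_sumr; apply: eq_bigr => j _; rewrite !mxE scalerA.
have F_continuous : continuous F.
  apply: continuous_big; first exact: add_continuous.
  move=> j _ v; apply: cvgZr_tmp; first exact: (nbhs_filter v).
  exact: (@coord_continuous R 1 d 0 j v).
pose S := [set v : 'rV[R]_d | `|v| = 1].
have S_compact : compact S.
  apply: bounded_closed_compact.
    exists 1; split; [exact: num_real|move=> M M1 v Sv].
    by rewrite /= (Sv : `|v| = 1) ltW.
  rewrite (_ : S = Num.norm @^-1` [set 1 : R]) //.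
  apply: preimage_closed; last exact: closed_eq.
  by move=> v _; exact: norm_continuous.
have [r r0 sep] : exists2 r : R, 0 < r &
    forall w v, S v -> `|w| < r -> ~ Pi (F v + w).
  move: S_compact => /compact_near_coveringP cov.
  suff cover v : S v -> \forall v' \near v & w \near (0 : X), ~ Pi (F v' + w).
    have : nbhs (0 : X) (fun w => S `<=` (fun v => ~ Pi (F v + w))).
      exact: (cov _ (nbhs (0 : X)) (fun w v => ~ Pi (F v + w)) _ cover).
    move=> /nbhs_ballP[r /= r0 hr]; exists r => // w v Sv wr.
    by apply: hr Sv; rewrite -ball_normE /= sub0r normrN.
  move=> Sv; have nPi : ~ Pi (F v).
    move=> PiF; have v0 : v = 0.
      by apply/rowP => j; rewrite mxE; exact: (e_free (fun j => v 0 j)).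
    by move: Sv; rewrite /S /= v0 normr0 => /eqP; rewrite eq_sym oner_eq0.
  have cv : (F q.1 + q.2) @[q --> (v, 0 : X)] --> F v.
    rewrite -[X in _ --> X]addr0; apply: cvgD; last exact: cvg_snd.
    have c1 : q.1 @[q --> (v, 0 : X)] --> v by exact: cvg_fst.
    exact: cvg_comp c1 (F_continuous v).
  apply: (cv (~` Pi)); apply: open_nbhs_nbhs; split => //.
  exact: closed_openC.
(* If the bound failed, dividing by the norm of [v] would give a point of the sphere too close to
   [Pi]. *)
have bound z v : Pi (z - F v) -> r * `|v| <= `|z|.
  move=> Pz; have [->|v0] := eqVneq v 0; first by rewrite normr0 mulr0.
  have nv0 : 0 < `|v| by rewrite normr_gt0.
  rewrite -ler_pdivlMr // leNgt; apply/negP => lt.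
  have Sv : S (`|v|^-1 *: v).
    by rewrite /S /= normrZ normfV normr_id mulVf // gt_eqF.
  apply: (sep ((- `|v|^-1) *: z) _ Sv).
    by rewrite normrZ normrN normfV normr_id mulrC.
  have -> : F (`|v|^-1 *: v) + (- `|v|^-1) *: z = (- `|v|^-1) *: (z - F v) + 0.
    by rewrite FZ addr0 scalerBr !scaleNr opprK addrC.
  by apply: PiD => //; exact/set_mem.
have [c cP] := choice (fun x => e_gen x).
pose c' x : 'rV[R]_d := \row_j c x j.
have c'P x : Pi (x - F (c' x)).
  by have := cP x; rewrite /F; under [in X in _ -> X]eq_bigr do rewrite mxE.
(* The coordinates come from a choice; this compatibility with differences modulo [Pi] replaces
   linearity and, with [bound], makes [c'] Lipschitz. *)
have c'B x y : Pi ((x - y) - F (c' x - c' y)).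
  have -> : x - y - F (c' x - c' y) = (x - F (c' x)) - (y - F (c' y)).
    by rewrite FB !opprB [F _ - F _]addrC [F _ - y]addrC addrACA.
  exact: PiB.
exists c' => [x|x y cxy].
  apply/cvgrPdist_lt => /= eps eps0; near=> y.
  rewrite -(ltr_pM2l r0); apply: le_lt_trans (bound _ _ (c'B x y)) _.
  near: y; apply: cvgr_dist_lt; first exact: cvg_id.
  exact: mulr_gt0.
have := c'B x y; rewrite cxy FB subrr subr0.
by [].
Unshelve. all: by end_near. Qed.

(** Closed subsets of the compact [A] have closed images, which makes the inverse continuous. Off
    the image [g] takes a default value. *)
Lemma compact_injective_homeomorphism {T : ptopologicalType}
    {U : topologicalType} (A : set T) (h : T -> U) :
  hausdorff_space U -> compact A -> {within A, continuous h} ->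
  {in A &, injective h} -> exists g, homeomorphism_on A (h @` A) h g.
Proof.
move=> hU cA hc hinj.
pose g u := xget point [set x | A x /\ h x = u].
have gK x : A x -> g (h x) = x.
  move=> Ax; have [Agx hgx] : A (g (h x)) /\ h (g (h x)) = h x.
    by apply: (@xgetI _ point [set z | A z /\ h z = h x] x).
  by apply: hinj => //; exact/mem_set.
exists g; split => //.
  by split => //; exact: subset_refl.
apply/subspace_continuousP => _ [x Ax <-]; rewrite /from_subspace gK // => W /= Wx.
have AW_compact : compact (A `&` ~` W°).
  by apply: compact_closedI => //; apply: open_closedC; exact: open_interior.
have hAW_closed : closed (h @` (A `&` ~` W°)).
  apply: compact_closed => //; apply: continuous_compact => //.
  by apply: continuous_subspaceW hc => z [].
have nx : nbhs (h x) (~` (h @` (A `&` ~` W°))).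
  apply: open_nbhs_nbhs; split; first exact: closed_openC.
  move=> [z [Az nWz] hzx]; apply: nWz.
  by rewrite (hinj z x) //; exact/mem_set.
apply: filterS nx => u nu [z Az hzu]; rewrite -hzu /= gK //.
apply: contrapT => nWz; apply: nu; exists z => //; split => //.
by move/interior_subset.
Qed.

Theorem theoremB (R : realType) (X : completeNormedModType R)
    (Phi : R -> X -> X) (Gamma : set X) (N : xnat) (C : xnat -> set X)
    (Pi : set X) (d : nat) :
  continuous_semiflow Phi ->
  eventually_compact Phi ->
  global_attractor Phi Gamma ->
  NICs Phi N C ->
  UESM_NICs Phi N C ->
  closed Pi -> linear_subspace Pi -> codimension_is Pi d ->
  (forall i : xnat, xnat_le (Some 1%N) i -> xnat_le i N ->
   forall x y : X, birkhoff_center Phi x -> birkhoff_center Phi y -> x <> y ->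
   (forall s : R, 0 < s ->
      exists x' y' : X,
        [/\ birkhoff_center Phi x', birkhoff_center Phi y',
            Phi s x' = x, Phi s y' = y &
            forall t : R, 0 <= t ->
              ((C i `\` pred_cone C i) `|` [set 0]) (Phi t x' - Phi t y')]) ->
   ~ Pi (x - y)) ->
  forall B : set X,
  (exists2 b, birkhoff_center Phi b &
     B = connected_component (birkhoff_center Phi) b) ->
  exists (K : set 'rV[R]_d) (h : X -> 'rV[R]_d) (g : 'rV[R]_d -> X),
    [/\ homeomorphism_on B K h g, compact K, connected K,
        (* Phi restricts to B, so that it can be transported to K *)
        (forall t : R, 0 <= t -> Phi t @` B `<=` B) &
        invariant_set (fun t => h \o Phi t \o g) K].
Proof.
move=> flow _ attr nics uesm Pi_closed Pi_linear Pi_codim Pi_sep B [b bb BE].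
have BBC : B `<=` birkhoff_center Phi.
  by rewrite BE; exact: connected_component_sub.
have B_closed : closed B.
  by rewrite BE; apply: component_closed; exact: closed_closure.
have B_compact : compact B.
  exact: (subclosed_compact B_closed (birkhoff_center_compact attr) BBC).
have B_connected : connected B by rewrite BE; exact: component_connected.
have B_invariant := birkhoff_component_invariant flow attr b.
rewrite -BE in B_invariant.
have [h h_continuous h_sep] :=
  codimension_coordinates Pi_closed Pi_linear Pi_codim.
(* Equal coordinates put [x - y] in [Pi], against the separation hypothesis at the level of the
   pair. *)
have h_inj : {in B &, injective h}.
  move=> x y /set_mem Bx /set_mem By hxy; apply: contrapT => xy.
  have bx := BBC _ Bx; have by_ := BBC _ By.
  have [i [i1 iN level]] :=
    birkhoff_center_NICs_level flow attr nics uesm bx by_ xy.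
  exact: Pi_sep i1 iN x y bx by_ xy level (h_sep x y hxy).
have hB : {within B, continuous h} by exact: continuous_subspaceT.
have [g hg] := compact_injective_homeomorphism
  (@norm_hausdorff _ _) B_compact hB h_inj.
exists (h @` B), h, g; split => //.
- exact: continuous_compact.
- exact: connected_continuous_connected.
- by move=> t t0; rewrite B_invariant.
- case: hg => _ gK _ _ t t0; apply/seteqP; split.
    move=> _ [_ [x Bx <-] <-] /=; rewrite gK //; exists (Phi t x) => //.
    by rewrite -(B_invariant t t0); exists x.
  move=> _ [x Bx <-]; have : (Phi t @` B) x by rewrite B_invariant.
  move=> [y By yx]; exists (h y); first by exists y.
  by rewrite /= gK // yx.
Qed.
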